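(* Let $q\in(-1,1)$, $|q|<t\le1$ and $\lambda>0$. Let $\boldsymbol{p}^{\lambda}_{q,t}=N_{q,t}+\sqrt{\lambda}\,(A_{q,t}^{\dagger}+A_{q,t})+\lambda\boldsymbol{1}$ be the $(q,t)$-Poisson type operator on the one-mode $(q,t)$-Fock space, $\varphi(b)=(b\,\Omega\,|\,\Omega)_{q,t}$ the vacuum expectation, and $\mu^{\lambda}_{q,t}$ the $(q,t)$-Poisson distribution. Then for every $n\ge1$ the $n$-th moment $m_n(\lambda)=\int_{\mathbb{R}}x^n\,d\mu^{\lambda}_{q,t}(x)$ of the $(q,t)$-Poisson distribution is given by $$m_n(\lambda)=\varphi\big((\boldsymbol{p}^{\lambda}_{q,t})^n\big)=\sum_{\substack{\text{contributors }Y\\ \text{of }n\text{ factors}}}\varphi(Y)=\sum_{\pi\in\mathcal{P}(n)}\lambda^{|\pi|}\,q^{\mathrm{rc}(\pi)}\,t^{\mathrm{rn}(\pi)},$$ where $\mathcal{P}(n)$ is the set of all partitions of $\{1,\dots,n\}$, $|\pi|$ is the number of blocks of $\pi$, $\mathrm{rc}(\pi)$ is the number of restricted crossings of $\pi$, and $\mathrm{rn}(\pi)$ is the number of restricted nestings of $\pi$.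
   Context: **$(q,t)$-numbers.** For $q\in(-1,1)$, $|q|<t\le1$, put $[n]_{q,t}=\frac{t^n-q^n}{t-q}=\sum_{k=1}^{n}t^{n-k}q^{k-1}$ for $n\ge1$, and $[0]_{q,t}=0$. **$(q,t)$-Fock space.** Let $\mathscr{H}$ be a real Hilbert space with inner product $\langle\cdot|\cdot\rangle$, and let $\mathcal{F}_{\mathrm{fin}}(\mathscr{H})$ be the complex vector space of finite linear combinations of elementary tensors $\xi_1\otimes\cdots\otimes\xi_n\in\mathscr{H}^{\otimes n}$, $n\ge0$, where $\mathscr{H}^{\otimes0}=\mathbb{C}\Omega$ with $\Omega$ a unit vector (the vacuum). The $(q,t)$-inner product is $$(\xi_1\otimes\cdots\otimes\xi_n\,|\,\eta_1\otimes\cdots\otimes\eta_m)_{q,t}=\delta_{m,n}\,t^{n(n-1)/2}\sum_{\sigma\in\mathfrak{S}_n}(q/t)^{i(\sigma)}\langle\xi_1|\eta_{\sigma(1)}\rangle\cdots\langle\xi_n|\eta_{\sigma(n)}\rangle,$$ where $i(\sigma)$ is the number of inversions of $\sigma$. It is positive definite, and $\mathcal{F}_{q,t}(\mathscr{H})$ is the completion of $\mathcal{F}_{\mathrm{fin}}(\mathscr{H})$ with respect to it. The one-mode case is $\mathscr{H}=\mathbb{R}\xi$ with $\|\xi\|=1$; then the vectors $\xi^{\otimes n}$, $n\ge0$ (with $\xi^{\otimes0}=\Omega$) are orthogonal and span a dense subspace. **Operators (one-mode).** The $(q,t)$-creation operator is given by $A_{q,t}^{\dagger}\xi^{\otimes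 n}=\xi^{\otimes(n+1)}$, $n\ge0$. The $(q,t)$-annihilation operator $A_{q,t}$ is the adjoint of $A_{q,t}^{\dagger}$ with respect to $(\cdot|\cdot)_{q,t}$; it acts by $A_{q,t}\Omega=0$ and $A_{q,t}\xi^{\otimes n}=[n]_{q,t}\xi^{\otimes(n-1)}$, $n\ge1$. The $(q,t)$-number operator is $N_{q,t}=A_{q,t}^{\dagger}A_{q,t}$. $\boldsymbol{1}$ denotes the identity operator. These operators are bounded and $\boldsymbol{p}^{\lambda}_{q,t}$ is self-adjoint. **$(q,t)$-Poisson distribution.** Define polynomials by $C_0(x)=1$, $C_1(x)=x-\lambda$, and $C_{n+1}(x)=\big(x-(\lambda+[n]_{q,t})\big)C_n(x)-\lambda[n]_{q,t}\,C_{n-1}(x)$ for $n\ge1$. The $(q,t)$-Poisson distribution $\mu^{\lambda}_{q,t}$ is the probability measure on $\mathbb{R}$ with respect to which the sequence $\{C_n\}_{n\ge0}$ is orthogonal (it exists by Favard's theorem and is unique since the recurrence coefficients are bounded). **Contributors.** Consider formal words $Y=Z_nZ_{n-1}\cdots Z_1$ of $n$ factors with each $Z_k$ one of the four letters $N_{q,t}$, $\sqrt{\lambda}A_{q,t}^{\dagger}$, $\sqrt{\lambda}A_{q,t}$, $\lambda\boldsymbol{1}$ (the $4^n$ words are regarded as distinct, even if the corresponding operators coincide). $\varphi(Y)$ is the vacuum expectation of the operator product. $Y$ is called a contributor if $\varphi(Y)\ne0$. **Partition statistics.** Let $\pi$ be a partition of $\{1,\dots,n\}$. For $e,f\in\{1,\dots,n\}$,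 $f$ follows $e$ in $\pi$ if $e<f$, $e$ and $f$ belong to the same block of $\pi$, and no element of this block lies strictly between $e$ and $f$. A quadruple $(a,b,c,d)$ of elements with $a<b<c<d$ is a restricted crossing of $\pi$ if $c$ follows $a$ in some block of $\pi$ and $d$ follows $b$ in another block of $\pi$; it is a restricted nesting of $\pi$ if $d$ follows $a$ in some block of $\pi$ and $c$ follows $b$ in another block of $\pi$. $\mathrm{rc}(\pi)$ and $\mathrm{rn}(\pi)$ are the numbers of restricted crossings and restricted nestings of $\pi$, respectively. *)

(* Defs.v *)
From HB Require Import structures.
From mathcomp Require Import all_boot all_order all_algebra all_fingroup.
From mathcomp Require Import complex.
From mathcomp Require Import all_classical all_reals all_analysis.

Set Implicit Arguments.
Unset Strict Implicit.
Unset Printing Implicit Defensive.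

Import Order.TTheory GRing.Theory Num.Theory.
Import numFieldNormedType.Exports.

Local Open Scope ring_scope.

Definition qt_number (R : realType) (q t : R) (n : nat) : R :=
  (t ^+ n - q ^+ n) / (t - q).

(* A complete normed space with such a form is a Hilbert space; forms of type
   {dot _ for conjC} are linear in their first argument. *)
Definition induces_norm (F : numFieldType) (theta : F -> F)
    (V : normedModType F) (dot : {dot V for theta}) : Prop :=
  forall x : V, dot x x = `|x| ^+ 2.

Definition inversions (n : nat) (s : 'S_n) : nat :=
  #|[set p : 'I_n * 'I_n | (p.1 < p.2)%N && (s p.2 < s p.1)%N]|.

(* The elementary tensor xi_1 (x) ... (x) xi_n is given by the sequence
   [:: xi_1; ...; xi_n]; the empty sequence gives the vacuum. *)
Definition qt_tensor_dot (R : realType) (q t : R) (H : normedModType R)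
    (dotH : {dot H for idfun}) (xis etas : seq H) : R :=
  let n := size xis in
  if size etas == n then
    t ^+ ((n * (n - 1)) %/ 2) *
    \sum_(s : 'S_n) (q / t) ^+ inversions s *
      \prod_(i < n) dotH (nth 0 xis i) (nth 0 etas (s i))
  else 0.

Definition tensor_span (R : realType) (H : normedModType R)
    (K : normedModType R[i]) (tens : seq H -> K) : set K :=
  [set x | exists (m : nat) (c : 'I_m -> R[i]) (w : 'I_m -> seq H),
    x = \sum_(i < m) c i *: tens (w i)]%classic.

(* The Hilbert space K, together with the map tens sending a sequence of
   vectors of H to their elementary tensor, is the completion of the space of
   finite combinations of elementary tensors for the (q,t)-inner product.
   As that inner product is definite, these conditions determine (K, tens) up
   to a unique unitary isomorphism. *)
Record is_qt_fock (R : realType) (q t : R) (H : completeNormedModType R)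
    (dotH : {dot H for idfun}) (K : completeNormedModType R[i])
    (dotK : {dot K for Num.conj}) (tens : seq H -> K) : Prop := {
  qt_fock_norm : induces_norm dotK;
  qt_fock_multilinear : forall (s1 s2 : seq H) (a : R) (u v : H),
    tens (s1 ++ (a *: u + v) :: s2) =
      (a%:C)%C *: tens (s1 ++ u :: s2) + tens (s1 ++ v :: s2);
  qt_fock_dot : forall xis etas : seq H,
    dotK (tens xis) (tens etas) = ((qt_tensor_dot q t dotH xis etas)%:C)%C;
  qt_fock_dense : dense (tensor_span tens)
}.

Definition bounded_operator (R : realType) (K : normedModType R[i])
    (b : K -> K) : Prop :=
  exists M : R[i], forall x : K, `|b x| <= M * `|x|.

Definition is_adjoint (R : realType) (K : normedModType R[i])
    (dotK : {dot K for Num.conj}) (b b' : K -> K) : Prop :=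
  forall x y : K, dotK (b x) y = dotK x (b' y).

Definition vacuum_exp (R : realType) (K : normedModType R[i])
    (dotK : {dot K for Num.conj}) (Omega : K) (b : K -> K) : R[i] :=
  dotK (b Omega) Omega.

Definition number_op (K : Type) (Ad A : K -> K) : K -> K := Ad \o A.

Definition poisson_op (R : realType) (K : normedModType R[i]) (lambda : R)
    (Ad A : K -> K) : K -> K :=
  fun x => number_op Ad A x + ((Num.sqrt lambda)%:C)%C *: (Ad x + A x)
           + (lambda%:C)%C *: x.

Inductive letter : Set := LNumber | LCreation | LAnnihilation | LScalar.

Definition letter_to_ord (z : letter) : 'I_4 :=
  match z with
  | LNumber => inord 0 | LCreation => inord 1
  | LAnnihilation => inord 2 | LScalar => inord 3
  end.

Definition letter_of_ord (i : 'I_4) : letter :=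
  match val i with
  | 0 => LNumber | 1 => LCreation | 2 => LAnnihilation | _ => LScalar
  end.

Lemma letter_to_ordK : cancel letter_to_ord letter_of_ord.
Proof. by case; rewrite /letter_of_ord /= inordK. Qed.

HB.instance Definition _ := Finite.copy letter (can_type letter_to_ordK).

Definition letter_op (R : realType) (K : normedModType R[i]) (lambda : R)
    (Ad A : K -> K) (z : letter) : K -> K :=
  match z with
  | LNumber => number_op Ad A
  | LCreation => fun x => ((Num.sqrt lambda)%:C)%C *: Ad x
  | LAnnihilation => fun x => ((Num.sqrt lambda)%:C)%C *: A x
  | LScalar => fun x => (lambda%:C)%C *: x
  end.

(* The word [:: Z_n; ...; Z_1] is the product Z_n ... Z_1: its last letter
   acts first. *)
Definition word_op (R : realType) (K : normedModType R[i]) (lambda : R)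
    (Ad A : K -> K) (Y : seq letter) : K -> K :=
  foldr (fun z b => letter_op lambda Ad A z \o b) idfun Y.

Fixpoint poisson_poly (R : realType) (q t lambda : R) (n : nat) : {poly R} :=
  match n with
  | 0 => 1
  | m.+1 =>
    match m with
    | 0 => 'X - lambda%:P
    | k.+1 =>
      ('X - (lambda + qt_number q t m)%:P) * poisson_poly q t lambda m
      - (lambda * qt_number q t m) *: poisson_poly q t lambda k
    end
  end.

Record is_qt_poisson (R : realType) (q t lambda : R)
    (mu : probability (measurableTypeR R) R) : Prop := {
  qt_poisson_moments : forall n : nat,
    mu.-integrable setT (fun x : R => (x ^+ n)%:E);
  qt_poisson_orthogonal : forall m n : nat, m != n ->
    \int[mu]_x ((poisson_poly q t lambda m).[x]
                * (poisson_poly q t lambda n).[x]) = 0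
}.

Definition follows (n : nat) (B : {set 'I_n}) (e f : 'I_n) : bool :=
  [&& (e < f)%N, e \in B, f \in B & [forall x in B, ~~ (e < x < f)%N]].

Definition restricted_crossings (n : nat) (P : {set {set 'I_n}}) : nat :=
  #|[set w : 'I_n * 'I_n * 'I_n * 'I_n | let: (a, b, c, d) := w in
     [&& (a < b)%N, (b < c)%N, (c < d)%N &
         [exists B in P, exists B' in P,
            [&& B != B', follows B a c & follows B' b d]]]]|.

Definition restricted_nestings (n : nat) (P : {set {set 'I_n}}) : nat :=
  #|[set w : 'I_n * 'I_n * 'I_n * 'I_n | let: (a, b, c, d) := w in
     [&& (a < b)%N, (b < c)%N, (c < d)%N &
         [exists B in P, exists B' in P,
            [&& B != B', follows B a d & follows B' b c]]]]|.

(* Main.v *)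
(* Let c(m, k) be the total weight of the ways of completing, with m further
   points, a partition k blocks of which are still open. A new point is a
   singleton or opens a block (weight lambda), or it is joined to one of the k
   open blocks, which it closes or not. If the block is the (j+1)-st one when
   they are listed by decreasing last element, j restricted crossings and k-1-j
   restricted nestings arise, so that these choices add up to [k]_{q,t}:
     c(m+1, k) = lambda c(m, k+1) + (lambda + [k]) c(m, k) + [k] c(m, k-1).
   In particular the sum over the partitions of n points is c(n, 0).
   The numbers (p^m e_k | Omega) / sqrt(lambda)^k, where e_k is the k-th tensor
   power of xi, and (integral of x^m C_k) / lambda^k satisfy the same recurrence and
   have the same values for m = 0. *)
Require Import Defs.
From HB Require Import structures.
From mathcomp Require Import all_boot all_order all_algebra all_fingroup.
From mathcomp Require Import complex.
From mathcomp Require Import all_classical all_reals all_analysis.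
From mathcomp Require Import ring zify.

Set Implicit Arguments.
Unset Strict Implicit.
Unset Printing Implicit Defensive.

Import Order.TTheory GRing.Theory Num.Theory.
Import numFieldNormedType.Exports.

Local Open Scope ring_scope.

(** * (q,t)-numbers and inversions *)

Section QtNumbers.
Variables (R : realType) (q t : R).

Lemma qt_number0 : qt_number q t 0 = 0.
Proof. by rewrite /qt_number !expr0 subrr mul0r. Qed.

Lemma qt_number_sum (n : nat) : q != t ->
  qt_number q t n = \sum_(i < n) t ^+ (n.-1 - i) * q ^+ i.
Proof.
by move=> qt; rewrite /qt_number subrXX mulrAC divff ?mul1r ?subr_eq0 1?eq_sym.
Qed.

Lemma qt_numberS (n : nat) : q != t ->
  qt_number q t n.+1 = t * qt_number q t n + q ^+ n.
Proof.
move=> qt; have td : t - q != 0 by rewrite subr_eq0 eq_sym.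
by rewrite /qt_number !exprS; field.
Qed.

(** The (q,t)-factorial, which turns out in [dot_tens_nseq] to be the squared norm of the n-th
    tensor power of [xi]. *)
Definition qt_fact (n : nat) : R := \prod_(i < n) qt_number q t i.+1.

End QtNumbers.

Lemma big_lift_perm (V : nmodType) (n : nat) (F : 'S_n.+1 -> V) :
  \sum_(s : 'S_n.+1) F s = \sum_(i < n.+1) \sum_(s : 'S_n) F (lift_perm ord0 i s).
Proof.
rewrite (partition_big (fun s : 'S_n.+1 => s ord0) xpredT) //=.
apply: eq_bigr => i _; rewrite (reindex (lift_perm ord0 i)); last first.
  (* [ulsf i s] deletes the position [i] and the value [s i] from [s]. The default of [odflt] is
     never reached, as [lift i k] differs from [i]. *)
  pose ulsf i (s : 'S_n.+1) k := odflt k (unlift (s i) (s (lift i k))).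
  have ulsfK j (s : 'S_n.+1) k : lift (s j) (ulsf j s k) = s (lift j k).
    rewrite /ulsf; have := neq_lift j k.
    by rewrite -(can_eq (permK s)) => /unlift_some[] ? ? ->.
  have inj_ulsf : injective (ulsf ord0 _).
    move=> s; apply: can_inj (ulsf (s ord0) s^-1%g) _ => k.
    by rewrite {1}/ulsf ulsfK !permK liftK.
  exists (fun s => perm (inj_ulsf s)) => [s _ | s].
    by apply/permP => k; rewrite permE /ulsf lift_perm_lift lift_perm_id liftK.
  move/(s _ =P _) => si0; apply/permP => k.
  case: (unliftP ord0 k) => [k'|] ->; rewrite ?lift_perm_id //.
  by rewrite lift_perm_lift -si0 permE ulsfK.
by apply: eq_bigl => s; rewrite lift_perm_id eqxx.
Qed.

Lemma inversions_sum (n : nat) (s : 'S_n) :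
  inversions s = (\sum_(i < n) \sum_(j < n) ((i < j) && (s j < s i)))%N.
Proof.
rewrite /inversions cardsE -sum1_card big_mkcond pair_big /=.
by apply: eq_bigr => -[i j] _; rewrite /in_mem /=; case: ifP.
Qed.

(** The first position is inverted with the positions of the [i] smaller values, all of which come
    later; the other pairs keep their order, lifting being increasing. *)
Lemma inversions_lift (n : nat) (i : 'I_n.+1) (s : 'S_n) :
  inversions (lift_perm ord0 i s) = (i + inversions s)%N.
Proof.
rewrite !inversions_sum big_ord_recl; congr (_ + _)%N.
  rewrite lift_perm_id big_ord_recl add0n.
  under eq_bigr => j _ do rewrite lift_perm_lift lift0 /=.
  (* Counting by values instead of positions removes [s]: what is left is the number of [j] below
     [i]. *)
  rewrite (reindex_inj (@perm_inj _ s^-1%g)) /=.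
  under eq_bigr => j _ do rewrite permKV.
  rewrite -(big_mkord xpredT (fun j => nat_of_bool (bump i j < i)%N)).
  rewrite (@big_cat_nat _ _ _ i) //=; last by rewrite -ltnS.
  rewrite [X in (_ + X)%N]big_nat_cond [X in (_ + X)%N]big1 ?addn0.
    rewrite big_nat_cond (eq_bigr (fun _ => 1%N)).
      by rewrite -big_nat_cond sum_nat_const_nat subn0 muln1.
    by move=> j /andP[/andP[_ ji] _]; rewrite /bump (leqNgt i j) ji /= add0n ji.
  move=> j /andP[/andP[ij _] _]; rewrite /bump ij add1n.
  by rewrite ltnNge leqW.
apply: eq_bigr => j _; rewrite big_ord_recl !lift0 /= add0n.
apply: eq_bigr => k _; rewrite !lift_perm_lift !ltnS.
have bumpm a b : (bump i a < bump i b)%N = (a < b)%N by rewrite ltnNge leq_bump2 -ltnNge.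
by rewrite /= bumpm.
Qed.

Lemma inversions_gf (R : comNzRingType) (x : R) (n : nat) :
  \sum_(s : 'S_n) x ^+ inversions s = \prod_(i < n) \sum_(j < i.+1) x ^+ j.
Proof.
elim: n => [|n IH].
  rewrite big_ord0 (big_pred1 1%g) => [|s /=]; last by apply/esym/eqP/permP => -[].
  by rewrite inversions_sum big_ord0.
rewrite big_lift_perm [RHS]big_ord_recr /= -IH mulr_sumr.
apply: eq_bigr => i _; rewrite mulr_suml.
by apply: eq_bigr => s _; rewrite inversions_lift exprD mulrC.
Qed.

(** The power of t is spread as t^i over the factors of the inversion generating function; the i-th
    factor then becomes the sum of the t^(i-j) q^j, which is [i+1]. *)
Lemma qt_fact_inversions (R : realType) (q t : R) (n : nat) : t != 0 -> q != t ->
  t ^+ ((n * (n - 1)) %/ 2) * \sum_(s : 'S_n) (q / t) ^+ inversions s = qt_fact q t n.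
Proof.
move=> t0 qt; rewrite inversions_gf subn1.
have -> : ((n * n.-1) %/ 2 = \sum_(i < n) i)%N.
  by rewrite -(big_mkord xpredT id) bin2_sum bin2 divn2.
rewrite expr_sum -big_split /=; apply: eq_bigr => i _.
rewrite qt_number_sum // mulr_sumr; apply: eq_bigr => j _ /=.
rewrite expr_div_n mulrA mulrAC -expfB_cond ?(negPf t0) //=.
by rewrite add0n -ltnS.
Qed.

(** * Partitions and predecessor functions *)

Lemma follows_lt (n : nat) (B : {set 'I_n}) (a c : 'I_n) : follows B a c -> (a < c)%N.
Proof. by case/and4P. Qed.

Lemma follows_inj_pred (n : nat) (B : {set 'I_n}) (a b c : 'I_n) :
  follows B a c -> follows B b c -> a = b.
Proof.
case/and4P=> ac aB _ /forall_inP Ha /and4P[bc bB _ /forall_inP Hb].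
apply/val_inj; move: (Ha _ bB) (Hb _ aB) => /=; lia.
Qed.

Lemma follows_inj_succ (n : nat) (B : {set 'I_n}) (a c d : 'I_n) :
  follows B a c -> follows B a d -> c = d.
Proof.
case/and4P=> ac _ cB /forall_inP Hc /and4P[ad _ dB /forall_inP Hd].
apply/val_inj; move: (Hc _ dB) (Hd _ cB) => /=; lia.
Qed.

Section PredecessorFunction.
Variable N : nat.
Implicit Types (f g : {ffun 'I_N -> option 'I_N}) (P : {set {set 'I_N}}).

(** A partition is encoded by sending each point to the preceding element of its block, or to [None]
    if it is the least one. The maps so obtained are those that go down and take no point as value
    twice. *)
Definition valid_pred f : bool :=
  [forall i, forall j, forall a, (f i == Some a) ==>
    (a < i)%N && ((f j == Some a) ==> (i == j))].

Lemma valid_predP f : reflect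
  ((forall i a, f i = Some a -> (a < i)%N) /\
   (forall i j a, f i = Some a -> f j = Some a -> i = j)) (valid_pred f).
Proof.
apply: (iffP idP) => [H|[H1 H2]].
  have {}H i j a : f i = Some a -> (a < i)%N && ((f j == Some a) ==> (i == j)).
    by move=> fi; move/forallP/(_ i)/forallP/(_ j)/forallP/(_ a): H; rewrite fi eqxx.
  split=> [i a /(H _ i)/andP[]//|i j a fi fj].
  by have /andP[_] := H _ j _ fi; rewrite fj eqxx => /eqP.
apply/forallP => i; apply/forallP => j; apply/forallP => a.
apply/implyP => /eqP fi; rewrite (H1 _ _ fi); apply/implyP => /eqP fj.
by rewrite (H2 _ _ _ fi fj).
Qed.

Definition pred_of P : {ffun 'I_N -> option 'I_N} :=
  [ffun i => [pick a | follows (finset.pblock P i) a i]].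

Lemma pred_of_follows P (i a : 'I_N) :
  (pred_of P i == Some a) = follows (finset.pblock P i) a i.
Proof.
rewrite ffunE; case: pickP => [b Hb|->//].
apply/eqP/idP => [[<-]//|Ha]; congr Some; exact: follows_inj_pred Hb Ha.
Qed.

Section OnePartition.
Variable P : {set {set 'I_N}}.
Hypothesis partP : finset.partition P [set: 'I_N].

Let tiP : finset.trivIset P. Proof. by case/and3P: partP. Qed.
Let inP i : i \in finset.cover P. Proof. by case/and3P: partP => /eqP -> _ _; rewrite inE. Qed.
Let mem_pb i : i \in finset.pblock P i. Proof. by rewrite mem_pblock. Qed.

Lemma pred_of_block (B : {set 'I_N}) (a c : 'I_N) :
  B \in P -> follows B a c -> pred_of P c = Some a.
Proof.
move=> PB fac; apply/eqP; rewrite pred_of_follows.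
by rewrite (def_pblock tiP PB) //; case/and4P: fac.
Qed.

Lemma pred_of_valid : valid_pred (pred_of P).
Proof.
apply/valid_predP; split=> [i a /eqP|i j a /eqP + /eqP].
  by rewrite pred_of_follows => /follows_lt.
rewrite !pred_of_follows => Hi Hj; apply: (follows_inj_succ Hi).
case/and4P: (Hi) => _ ai _ _; case/and4P: (Hj) => _ aj _ _.
by rewrite -(same_pblock tiP ai) (same_pblock tiP aj).
Qed.

(** If the block had elements below [i], the largest of them would be the predecessor of [i]. *)
Lemma pred_of_None (i j : 'I_N) :
  pred_of P i = None -> j \in finset.pblock P i -> (i <= j)%N.
Proof.
move=> fi jB; rewrite leqNgt; apply/negP => ji.
pose Q (k : 'I_N) := (k \in finset.pblock P i) && (k < i)%N.
have Qj : Q j by rewrite /Q jB.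
case: (@arg_maxnP _ j Q (fun k => nat_of_ord k) Qj) => k /andP[kB ki] kmax.
suff : pred_of P i == Some k by rewrite fi.
rewrite pred_of_follows; apply/and4P; split=> //.
apply/forall_inP => x xB; apply/negP => /andP[kx xi].
by have := kmax x; rewrite /Q xB xi => /(_ isT) /=; lia.
Qed.

(** Each block has exactly one point without predecessor, its least element. *)
Lemma card_pred_of_None : #|P| = #|[set i | pred_of P i == None]|.
Proof.
rewrite -(@card_in_imset _ _ (finset.pblock P)) => [|i j]; last first.
  rewrite !inE => /eqP fi /eqP fj eij; apply/val_inj/anti_leq/andP; split.
    by apply: (pred_of_None fi); rewrite eij.
  by apply: (pred_of_None fj); rewrite -eij.
apply: eq_card => B; apply/idP/imsetP => [PB|[i _ ->]]; last exact: pblock_mem.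
have /finset.set0Pn[x xB] : B != finset.set0 by apply: partition_neq0 partP PB.
case: (@arg_minnP _ x (fun k => k \in B) (fun k => nat_of_ord k) xB) => k kB kmin.
exists k; last by rewrite (def_pblock tiP PB kB).
rewrite inE; case E: (pred_of P k) => [a|//].
move/eqP: E; rewrite pred_of_follows (def_pblock tiP PB kB) => /and4P[ak aB _ _].
by have := kmin a aB; move: ak => /=; lia.
Qed.

End OnePartition.

(** Descending from [y] through predecessors reaches every smaller element of its block, so the
    predecessor map determines which points share a block. *)
Lemma pred_of_inj P P' : finset.partition P [set: 'I_N] ->
  finset.partition P' [set: 'I_N] -> pred_of P = pred_of P' -> P = P'.
Proof.
wlog suff sub : P P' / finset.partition P [set: 'I_N] ->
    finset.partition P' [set: 'I_N] -> pred_of P = pred_of P' ->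
    forall x y : 'I_N, y \in finset.pblock P x -> y \in finset.pblock P' x.
  move=> pP pP' e.
  rewrite -(equivalence_partition_pblock pP) -(equivalence_partition_pblock pP').
  apply: eq_in_imset => x _; apply/setP => y; rewrite !inE /=.
  by apply/idP/idP; apply: sub.
move=> pP pP' e.
have [/eqP cP tP _] := and3P pP; have [/eqP cP' tP' _] := and3P pP'.
(* Induction on a bound [m] of [y]: the predecessor [z] of [y] is the same for both partitions, and
   [x] is [z] or lies below it. *)
have down m (x y : 'I_N) : (y <= m)%N -> (x < y)%N ->
    x \in finset.pblock P y -> x \in finset.pblock P' y.
  elim: m x y => [|m IH] x y ym xy xB; first by lia.
  case E: (pred_of P y) => [z|]; last first.
    by have := pred_of_None pP E xB; rewrite leqNgt xy.
  have := E; rewrite e => /eqP; rewrite pred_of_follows => /and4P[zy zB' _ _].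
  move/eqP: E; rewrite pred_of_follows => /and4P[_ zB _ /forall_inP/(_ _ xB)].
  rewrite xy andbT -leqNgt leq_eqVlt => /orP[/eqP/val_inj->//|xz].
  rewrite -(same_pblock tP' zB'); apply: IH => //; first by lia.
  by rewrite (same_pblock tP zB).
move=> x y yB; have [yx|xy|/val_inj->] := ltngtP y x.
- exact: (down x).
- have xP : x \in finset.cover P' by rewrite cP' inE.
  have yP : y \in finset.cover P' by rewrite cP' inE.
  rewrite -eq_pblock // eq_sym eq_pblock //; apply: (down y) => //.
  have {}xP : x \in finset.cover P by rewrite cP inE.
  by rewrite (same_pblock tP yB) mem_pblock.
- by rewrite mem_pblock cP' inE.
Qed.

(* The smallest element of the block of i, reached by following predecessors. *)
Definition root f (i : 'I_N) : 'I_N := iter N (fun j => odflt j (f j)) i.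

Definition part_of f : {set {set 'I_N}} := preim_partition (root f) [set: 'I_N].

Lemma part_of_partition f : finset.partition (part_of f) [set: 'I_N].
Proof. exact: preim_partitionP. Qed.

Lemma mem_pblock_part_of f x y : (y \in finset.pblock (part_of f) x) = (root f x == root f y).
Proof.
by rewrite /part_of /preim_partition pblock_equivalence_partition ?inE // => a b c *;
  split=> // /eqP ->.
Qed.

Section Root.
Variable f : {ffun 'I_N -> option 'I_N}.
Hypothesis vf : valid_pred f.
Let flt := (elimT (valid_predP f) vf).1.
Let finj := (elimT (valid_predP f) vf).2.

Lemma root_fixed (i : 'I_N) : f (root f i) = None.
Proof.
(* A step that is not stationary goes down by at least one. After k steps the descent has ended or
   has lost k; for k = N the latter is impossible, [i] being below N. *)
suff H k : f (iter k (fun j => odflt j (f j)) i) = None \/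
    (iter k (fun j => odflt j (f j)) i + k <= i)%N.
  by case: (H N) => // H'; have := ltn_ord i; lia.
elim: k => [|k IH]; first by right; rewrite addn0.
rewrite iterS; set x := iter k _ i in IH *.
case E: (f x) => [a|] /=; last by left; rewrite E.
case: IH => [|IH]; first by rewrite E.
by right; have := flt E; lia.
Qed.

Lemma root_None (i : 'I_N) : f i = None -> root f i = i.
Proof. by move=> fi; rewrite /root iter_fix // fi. Qed.

Lemma root_Some (i a : 'I_N) : f i = Some a -> root f i = root f a.
Proof.
move=> fi; rewrite [in RHS]/root.
have -> : a = odflt i (f i) by rewrite fi.
(* N steps from [a] are N+1 steps from [i], and the last of these does not move. *)
by rewrite -iterSr iterS -/(root f i) root_fixed.
Qed.

Lemma root_le (i : 'I_N) : (root f i <= i)%N.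
Proof.
suff H k : (iter k (fun j => odflt j (f j)) i <= i)%N by apply: H.
elim: k => //= k IH; apply: leq_trans IH.
by case E: (f _) => [a|] //=; apply/ltnW/flt.
Qed.

(** Here injectivity makes the points with a common root a chain rather than a tree. Let [w] be the
    predecessor of [x]: if w < z, induction gives [w] a successor at or below [z], which cannot be
    [x]; if z < w, induction applies to [z] and [w]. *)
Lemma root_succ (x z : 'I_N) : (z < x)%N -> root f z = root f x ->
  exists2 y : 'I_N, (y <= x)%N & f y = Some z.
Proof.
elim/ltn_ind: {x}(nat_of_ord x) {-2}x (erefl (nat_of_ord x)) z => m IH x xm z zx rzx.
case E: (f x) => [w|]; last first.
  by have := root_le z; rewrite rzx root_None // leqNgt zx.
have wx := flt E; have rw := root_Some E.
have [wz|zw|/val_inj wz] := ltngtP w z.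
- have [||y yz fy] := IH z _ z (erefl _) w wz; rewrite -?xm //; first by rewrite -rw.
  by move: yz; rewrite (finj fy E) leqNgt zx.
- have [||y yw fy] := IH w _ w (erefl _) z zw; rewrite -?xm //; first by rewrite rzx.
  by exists y => //; apply: leq_trans yw (ltnW wx).
- by exists x => //; rewrite E wz.
Qed.

(** By [root_succ], a point [x] with a larger point [y] in its block has a successor not beyond [y].
    Hence no block element separates a point from its successor, and the element that follows [x] is
    that successor. *)
Lemma part_ofK : pred_of (part_of f) = f.
Proof.
suff H (x y : 'I_N) : f y = Some x <-> follows (finset.pblock (part_of f) y) x y.
  apply/ffunP => y; case E: (f y) => [x|].
    by apply/eqP; rewrite pred_of_follows; apply/H.
  case E': (pred_of _ y) => [x|//]; move/eqP: E'; rewrite pred_of_follows.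
  by move/H; rewrite E.
rewrite /follows !mem_pblock_part_of eqxx /=; split=> [fy|].
  rewrite flt // (root_Some fy) eqxx /=; apply/forall_inP => z.
  rewrite mem_pblock_part_of (root_Some fy) => /eqP rz; apply/negP => /andP[xz zy].
  have [u uz fu] := root_succ xz rz.
  by move: uz; rewrite (finj fu fy) leqNgt zy.
case/and3P=> xy /eqP rxy /forall_inP H.
have [u uy fu] := root_succ xy (esym rxy).
have := H u; rewrite mem_pblock_part_of rxy (root_Some fu) eqxx flt //= => /(_ isT).
rewrite -leqNgt => yu; suff -> : y = u by [].
by apply/val_inj/anti_leq; rewrite yu uy.
Qed.

End Root.

Lemma sum_partition_pred (V : nmodType) (F : {ffun 'I_N -> option 'I_N} -> V) :
  \sum_(P : {set {set 'I_N}} | finset.partition P [set: 'I_N]) F (pred_of P) =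
  \sum_(f | valid_pred f) F f.
Proof.
rewrite (reindex_onto part_of pred_of) => [|P partP]; last first.
  apply: pred_of_inj => //; first exact: part_of_partition.
  exact/part_ofK/pred_of_valid.
apply: eq_big => f; last by case/andP=> _ /eqP ->.
rewrite part_of_partition /=; apply/eqP/idP => [<-|]; last exact: part_ofK.
exact/pred_of_valid/part_of_partition.
Qed.

End PredecessorFunction.

(** * Counting partitions by open blocks *)

(* The weight of the completions, over m further points, of a partition with
   k blocks left open: each point is a singleton, opens a block, or prolongs or
   closes one of the open blocks. *)
Fixpoint completions (R : realType) (q t lambda : R) (m k : nat) : R :=
  if m is m'.+1 then
    lambda * completions q t lambda m' k.+1
    + (lambda + qt_number q t k) * completions q t lambda m' k
    + qt_number q t k * completions q t lambda m' k.-1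
  else (k == 0%N)%:R.

Lemma big_option (V : nmodType) (T : finType) (F : option T -> V) :
  \sum_p F p = F None + \sum_a F (Some a).
Proof.
rewrite (bigD1 None) //=; congr (_ + _).
have [x _|T0] := pickP (fun _ : T => true); last first.
  by rewrite !big1 // => [a _|[a|] //]; have := T0 a.
rewrite (reindex_onto Some (fun p => odflt x p)) => [|[]//].
by apply: eq_bigl => a; rewrite eqxx.
Qed.

Section Weights.
Variables (R : realType) (q t lambda : R).
Hypothesis qt : q != t.
Variable N : nat.
Implicit Types (f g : {ffun 'I_N -> option 'I_N}) (O : {set 'I_N}).

(** Each such point stands for a block still open at [m], of which it is the last element so far. *)
Definition opens f (m : nat) : {set 'I_N} :=
  [set b : 'I_N | (b < m)%N && [exists d : 'I_N, (m <= d)%N && (f d == Some b)]].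

(** When a point is joined to [a], each open block whose last element is above [a] yields a
    restricted crossing, each one below [a] a restricted nesting. A block receives its factor
    [lambda] at its least element. *)
Definition step_weight O (p : option 'I_N) : R :=
  if p is Some a then
    q ^+ #|[set b in O | (a < b)%N]| * t ^+ #|[set b in O | (b < a)%N]|
  else lambda.

(** The least element [m] is removed from [O]: it lies below every other choice, which costs a
    factor t, and its own weight is q^k since the k others lie above it. This is [k+1] = t [k] +
    q^k. *)
Lemma sum_step_weight O :
  \sum_(a in O) step_weight O (Some a) = qt_number q t #|O|.
Proof.
elim: {O}#|O| {-2}O (erefl #|O|) => [|k IH] O Ok.
  by rewrite (cards0_eq Ok) big_set0 cards0 qt_number0.
have /card_gt0P[x xO] : (0 < #|O|)%N by rewrite Ok.
case: (@arg_minnP _ x (fun b => b \in O) (fun b => nat_of_ord b) xO) => m mO mmin.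
have Ok' : #|O :\ m| = k by move: Ok; rewrite (cardsD1 m) mO => -[].
have IHm := IH _ Ok'; rewrite Ok' in IHm.
rewrite (bigD1 m) //= Ok qt_numberS // -IHm addrC mulr_sumr; congr (_ + _).
  rewrite [LHS](eq_bigl (fun b => b \in O :\ m)) => [|b]; last by rewrite !inE andbC.
  apply: eq_bigr => a; rewrite !inE => /andP[am aO].
  have ma : (m < a)%N by move: am (mmin a aO); rewrite -val_eqE /=; lia.
  rewrite /step_weight (cardsD1 m [set b in O | (b < a)%N]) !inE mO ma /= add1n exprS.
  rewrite mulrCA; congr (_ * (_ * _)).
    congr (_ ^+ _); apply: eq_card => b; rewrite !inE.
    by have [->|//] := eqVneq b m; rewrite mO ltnNge ltnW.
  by congr (_ ^+ _); apply: eq_card => b; rewrite !inE andbA.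
rewrite /step_weight [X in t ^+ X](_ : _ = 0%N); last first.
  apply: eq_card0 => b; rewrite !inE; apply/negP => /andP[bO bm].
  by move: (mmin b bO) => /=; lia.
rewrite mulr1 -Ok'; congr (_ ^+ _); apply: eq_card => b; rewrite !inE.
have [bO|] := boolP (b \in O); rewrite ?andbF ?andbT //=.
by move: (mmin b bO); rewrite -val_eqE /=; lia.
Qed.

(** The flag [b] tells whether [M] itself will have a successor. *)
Definition next_opens O (M : 'I_N) (p : option 'I_N) (b : bool) : {set 'I_N} :=
  (if p is Some a then O :\ a else O) :|: (if b then [set M] else finset.set0).

Lemma in_next_opens O (M : 'I_N) (p : option 'I_N) (b : bool) x :
  (x \in next_opens O M p b) = (x \in O) && (p != Some x) || b && (x == M).
Proof.
rewrite /next_opens !inE; congr (_ || _); last by case: b; rewrite !inE.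
by case: p => [a|]; rewrite ?andbT // !inE andbC eq_sym.
Qed.

Lemma opensS f (M : 'I_N) : valid_pred f ->
  opens f M.+1 = next_opens (opens f M) M (f M) (M \in opens f M.+1).
Proof.
move=> /valid_predP[flt finj]; apply/setP => b; rewrite in_next_opens.
have [->|bM] := eqVneq b M; first by rewrite andbT !inE ltnn.
rewrite andbF orbF !inE ltnS leq_eqVlt -(inj_eq val_inj) in bM *.
rewrite (negPf bM) /=; case: ltnP => //= bltM; apply/existsP/andP.
  case=> d /andP[Md /eqP fd]; split.
    by apply/existsP; exists d; rewrite fd eqxx ltnW.
  by apply/eqP => /(finj _ _ _ fd) e; rewrite e ltnn in Md.
case=> /existsP[d /andP[Md /eqP fd]] fM; exists d; rewrite fd eqxx andbT.
rewrite ltn_neqAle Md andbT; apply: contraNneq fM => /val_inj ->.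
by rewrite fd.
Qed.

(* f continues the assignment g of predecessors to the points below m, the set
   of points that still await a successor being O. *)
Definition agrees g O (m : nat) f : bool :=
  [&& valid_pred f, [forall i : 'I_N, (i < m)%N ==> (f i == g i)] & opens f m == O].

(** Invariant of the induction in [sum_agrees]: from [m] on [g] holds the placeholder [None], and
    joining a new point to an element of [O] keeps the map valid. *)
Definition prefix_ok g O (m : nat) : Prop :=
  [/\ valid_pred g, forall i : 'I_N, (m <= i)%N -> g i = None,
      forall a, a \in O -> (a < m)%N & forall a i, a \in O -> g i != Some a].

Definition extend g (M : 'I_N) (p : option 'I_N) : {ffun 'I_N -> option 'I_N} :=
  [ffun i => if i == M then p else g i].

Definition allowed O (p : option 'I_N) : bool := if p is Some a then a \in O else true.

Lemma prefix_ok_extend g O (M : 'I_N) p b :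
  prefix_ok g O M -> allowed O p -> prefix_ok (extend g M p) (next_opens O M p b) M.+1.
Proof.
move=> [/valid_predP[glt ginj] gN OM gO] ok; split.
- apply/valid_predP; split=> [i a|i j a]; rewrite !ffunE.
    have [->|_] := eqVneq i M; last exact: glt.
    by move=> e; rewrite e in ok; apply: OM.
  have [->|iM] := eqVneq i M; have [->|jM] := eqVneq j M => //.
  + by move=> e gj; rewrite e in ok; have := gO _ j ok; rewrite gj eqxx.
  + by move=> gi e; rewrite e in ok; have := gO _ i ok; rewrite gi eqxx.
  + exact: ginj.
- move=> i Mi; rewrite ffunE ifN; first by apply: gN; apply: ltnW.
  by apply: contraTneq Mi => ->; rewrite ltnn.
- move=> a; rewrite in_next_opens => /orP[/andP[/OM/ltnW//]|/andP[_ /eqP->]//].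
- move=> a i; rewrite in_next_opens ffunE => /orP[/andP[aO pa]|/andP[_ /eqP->]].
    by case: ifP => // _; apply: gO.
  have [_|iM] := eqVneq i M.
    by apply/eqP => e; rewrite e in ok; have := OM _ ok; rewrite ltnn.
  apply/eqP => gi; have Mi := glt _ _ gi.
  by move: gi; rewrite gN // ltnW.
Qed.

(** The continuations of [g] are sorted by the choice at [M]: its predecessor [p], and whether it
    remains open. Each class consists of the continuations of a prefix one point longer. *)
Lemma agrees_extend g O (M : 'I_N) p b f : prefix_ok g O M ->
  agrees g O M f && ((f M, M \in opens f M.+1) == (p, b)) =
  allowed O p && agrees (extend g M p) (next_opens O M p b) M.+1 f.
Proof.
move=> [_ _ OM _]; apply/idP/idP.
  case/andP=> /and3P[vf /forallP fg /eqP fO] /eqP[fM fb]; have /valid_predP[flt finj] := vf.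
  rewrite /agrees vf -fb -fO -fM -opensS // eqxx andbT /=; apply/andP; split.
    case E: (f M) => [a|//] /=; rewrite !inE (flt _ _ E) /=.
    by apply/existsP; exists M; rewrite leqnn E eqxx.
  apply/forallP => i; apply/implyP; rewrite ltnS leq_eqVlt ffunE => /orP[|iM].
    by move/eqP/val_inj ->; rewrite eqxx.
  by rewrite -(inj_eq val_inj) /= (ltn_eqF iM); move/implyP: (fg i); apply.
case/andP=> ok /and3P[vf /forallP fg /eqP fO].
have fM : f M = p by have /implyP/(_ (leqnn _))/eqP := fg M; rewrite ffunE eqxx.
have MO : M \notin O by apply/negP => /OM; rewrite ltnn.
have fb : (M \in opens f M.+1) = b.
  by rewrite fO in_next_opens (negPf MO) eqxx andbT.
rewrite /agrees vf fM fb eqxx andbT /=; apply/andP; split.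
  apply/forallP => i; apply/implyP => iM.
  have /implyP/(_ (ltnW iM)) := fg i.
  by rewrite ffunE -(inj_eq val_inj) /= (ltn_eqF iM).
have := opensS M vf; rewrite fb fM fO.
move=> /setP eqO; apply/eqP/setP => x; have {eqO} := eqO x.
rewrite !in_next_opens.
have [-> _|xM] := eqVneq x M; first by rewrite (negPf MO) !inE ltnn.
rewrite !andbF !orbF; have [px|] := eqVneq p (Some x); last by rewrite !andbT.
move=> _; rewrite px /= in ok; rewrite ok inE OM //=.
by apply/existsP; exists M; rewrite leqnn fM px eqxx.
Qed.

Lemma card_next_opens_None O (M : 'I_N) b : M \notin O ->
  #|next_opens O M None b| = (#|O| + b)%N.
Proof.
move=> MO; case: b; rewrite /next_opens ?finset.setU0 ?addn0 //.
by rewrite finset.setUC cardsU1 MO addnC.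
Qed.

Lemma card_next_opens_Some O (M : 'I_N) a b : M \notin O -> a \in O ->
  #|next_opens O M (Some a) b| = (#|O|.-1 + b)%N.
Proof.
move=> MO aO; have -> : #|O|.-1 = #|O :\ a| by rewrite (cardsD1 a O) aO.
case: b; rewrite /next_opens ?finset.setU0 ?addn0 //.
by rewrite finset.setUC cardsU1 !inE (negPf MO) andbF addnC.
Qed.

Definition pred_weight f (i : 'I_N) : R := step_weight (opens f i) (f i).

(** The weight at the point [m] depends only on [O] and on the predecessor chosen, so it factors out
    of each class of continuations; the rest depends on the number of open blocks alone. *)
Lemma sum_agrees g O (m : nat) : (m <= N)%N -> prefix_ok g O m ->
  \sum_(f | agrees g O m f) \prod_(i < N | (m <= i)%N) pred_weight f i =
  completions q t lambda (N - m) #|O|.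
Proof.
move Ek : (N - m)%N => k; elim: k m Ek g O => [|k IH] m Ek g O mN ok.
  (* No point is left: the only candidate is [g] itself, and nothing can be open at N. *)
  have {mN Ek} -> : m = N by lia.
  have opN f : opens f N = finset.set0.
    apply/setP => b; rewrite !inE ltn_ord /=; apply/existsP => -[d].
    by rewrite leqNgt ltn_ord.
  have ag f : agrees g O N f = (f == g) && (O == finset.set0).
    rewrite /agrees opN (eq_sym O); case: eqP => _; rewrite ?andbF ?andbT //.
    apply/andP/eqP => [[_ /forallP fg]|->].
      by apply/ffunP => i; have := fg i; rewrite ltn_ord => /eqP.
    by case: ok => -> _ _ _; split=> //; apply/forallP => i; rewrite eqxx implybT.
  rewrite (eq_bigl _ _ ag) /= cards_eq0; case: (O == _); last first.
    by rewrite big_pred0 // => f; rewrite andbF.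
  rewrite (big_pred1 g) => [|f]; last by rewrite andbT.
  by rewrite big_pred0 // => i; rewrite leqNgt ltn_ord.
have mlt : (m < N)%N by lia.
pose M := Ordinal mlt; rewrite -[m]/(nat_of_ord M) in Ek ok *.
have MO : M \notin O by apply/negP => MO; case: ok => _ _ /(_ _ MO); rewrite ltnn.
rewrite (partition_big (fun f => (f M, M \in opens f M.+1)) xpredT) //=.
pose S p b := if allowed O p then
  step_weight O p * completions q t lambda k #|next_opens O M p b| else 0.
rewrite (eq_bigr (fun pb => S pb.1 pb.2)) => [|[p b] _ /=]; last first.
  rewrite (eq_bigl _ _ (fun f => agrees_extend p b f ok)) /S; case: ifP => okp; last first.
    by rewrite big_pred0.
  rewrite -(IH M.+1 _ (extend g M p)) //; [|lia|exact: prefix_ok_extend].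
  rewrite mulr_sumr; apply: eq_bigr => f agf.
  rewrite (bigD1 M) //=; congr (_ * _).
    have : allowed O p && agrees (extend g M p) (next_opens O M p b) M.+1 f by rewrite okp.
    rewrite -agrees_extend // => /andP[/and3P[_ _ /eqP fO] /eqP[fM _]].
    by rewrite /pred_weight fO fM.
  by apply: eq_bigl => i; rewrite -(inj_eq val_inj) /= (ltn_neqAle m i) andbC eq_sym.
rewrite -(pair_bigA _ S) /= big_option.
have -> (p : option 'I_N) : \sum_b S p b = S p true + S p false by rewrite big_bool.
(* Without predecessor, [M] opens a block or is a singleton; with one, it prolongs a block, leaving
   their number unchanged, or closes it. *)
rewrite {1 2}/S /= !card_next_opens_None // addn1 addn0.
rewrite (eq_bigr (fun a => if a \in O then step_weight O (Some a) *
   (completions q t lambda k #|O|.-1.+1 + completions q t lambda k #|O|.-1) else 0)); last first.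
  move=> a _; rewrite big_bool /S /=; case: ifP => aO; last by rewrite addr0.
  by rewrite !card_next_opens_Some // addn1 addn0 mulrDr.
rewrite -big_mkcond -mulr_suml /= sum_step_weight /step_weight.
(* For empty [O] the index [#|O|.-1.+1] is 1 instead of 0, but its coefficient [0] vanishes. *)
have [->|O0] := posnP #|O|; first by rewrite qt_number0 !mul0r !addr0.
by rewrite prednK //; ring.
Qed.

Lemma sum_pred_weight :
  \sum_(f : {ffun 'I_N -> option 'I_N} | valid_pred f) \prod_i pred_weight f i =
  completions q t lambda N 0.
Proof.
have ok : prefix_ok [ffun => None] finset.set0 0.
  split=> [|i _|a|a i]; rewrite ?inE ?ffunE //.
  by apply/valid_predP; split=> [i a|i j a]; rewrite ffunE.
have := sum_agrees (leq0n N) ok; rewrite subn0 cards0 => <-.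
apply: eq_bigl => f; rewrite /agrees; case: (valid_pred f) => //=.
apply/esym/andP; split; first by apply/forallP.
by apply/eqP/setP => b; rewrite !inE.
Qed.

End Weights.

(** * Restricted crossings and nestings as counts of open points *)

Section PartitionWeight.
Variables (R : realType) (q t lambda : R) (N : nat).
Variable P : {set {set 'I_N}}.
Hypothesis partP : finset.partition P [set: 'I_N].
Let f := pred_of P.

Let cP i : i \in finset.cover P. Proof. by case/and3P: partP => /eqP -> _ _; rewrite inE. Qed.

Lemma blocks_crossing (a b c d : 'I_N) : (a < b)%N -> (b < c)%N -> (c < d)%N ->
  [exists B in P, exists B' in P, [&& B != B', follows B a c & follows B' b d]] =
  (f c == Some a) && (f d == Some b).
Proof.
move=> ab bc cd; apply/exists_inP/andP => [[B PB /exists_inP[B' PB' /and3P[_ ac bd]]]|].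
  by rewrite (pred_of_block partP PB ac) (pred_of_block partP PB' bd).
rewrite !pred_of_follows => -[ac bd].
exists (finset.pblock P c); first exact: pblock_mem.
apply/exists_inP; exists (finset.pblock P d); first exact: pblock_mem.
(* If the two blocks were equal, [b] would lie in the block strictly between [a] and [c], which
   follows [a]. *)
rewrite ac bd !andbT; apply/eqP => e; case/and4P: ac => _ _ _ /forall_inP/(_ b).
by rewrite e ab bc; case/and4P: bd => _ -> _ _ /(_ isT).
Qed.

Lemma blocks_nesting (a b c d : 'I_N) : (a < b)%N -> (b < c)%N -> (c < d)%N ->
  [exists B in P, exists B' in P, [&& B != B', follows B a d & follows B' b c]] =
  (f d == Some a) && (f c == Some b).
Proof.
move=> ab bc cd; apply/exists_inP/andP => [[B PB /exists_inP[B' PB' /and3P[_ ac bd]]]|].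
  by rewrite (pred_of_block partP PB ac) (pred_of_block partP PB' bd).
rewrite !pred_of_follows => -[ad bcf].
exists (finset.pblock P d); first exact: pblock_mem.
apply/exists_inP; exists (finset.pblock P c); first exact: pblock_mem.
rewrite ad bcf !andbT; apply/eqP => e; case/and4P: ad => _ _ _ /forall_inP/(_ b).
by rewrite e ab (ltn_trans bc cd); case/and4P: bcf => _ -> _ _ /(_ isT).
Qed.

Lemma card_pairs_sum (Q : 'I_N -> 'I_N -> 'I_N -> bool) :
  #|[set w : 'I_N * 'I_N | if f w.1 is Some a then Q a w.1 w.2 else false]| =
  (\sum_i (if f i is Some a then #|[set b | Q a i b]| else 0))%N.
Proof.
rewrite -sum1_card big_mkcond /=.
pose F (i b : 'I_N) := if f i is Some a then nat_of_bool (Q a i b) else 0%N.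
rewrite (eq_bigr (fun w => F w.1 w.2)) => [|[i b] _]; last first.
  by rewrite /F inE /=; case: (f i) => // a; case: (Q _ _ _).
rewrite -(pair_bigA _ F) /F.
apply: eq_bigr => i _ /=; case E: (f i) => [a|].
  by rewrite -sum1_card [RHS]big_mkcond; apply: eq_bigr => b _; rewrite inE; case: (Q _ _ _).
by rewrite big1.
Qed.

(* A crossing (a, b, c, d) is determined by c and by the point b, open at c. *)
Lemma restricted_crossings_opens : restricted_crossings P =
  (\sum_i (if f i is Some a then #|[set b in opens f i | (a < b)%N]| else 0))%N.
Proof.
have /valid_predP[_ finj] := pred_of_valid partP.
rewrite -(card_pairs_sum (fun a i b => (b \in opens f i) && (a < b)%N)).
pose h (w : 'I_N * 'I_N * 'I_N * 'I_N) := (w.1.2, w.1.1.2).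
have inQ w : (w \in [set w : 'I_N * 'I_N * 'I_N * 'I_N | let: (a, b, c, d) := w in
     [&& (a < b)%N, (b < c)%N, (c < d)%N &
         [exists B in P, exists B' in P,
            [&& B != B', follows B a c & follows B' b d]]]]) ->
   [/\ (w.1.1.1 < w.1.1.2 < w.1.2)%N, (w.1.2 < w.2)%N, f w.1.2 = Some w.1.1.1
     & f w.2 = Some w.1.1.2].
  case: w => -[[a b] c] d; rewrite inE => /and4P[ab bc cd].
  by rewrite blocks_crossing // => /andP[/eqP fc /eqP fd]; split; rewrite ?ab.
rewrite /restricted_crossings -(@card_in_imset _ _ h) => [|w w' /inQ + /inQ]; last first.
  case: w w' => -[[a b] c] d [[[a' b'] c'] d'] /= [_ _ fc fd] [_ _ fc' fd'] [ec eb].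
  subst b' c'; move: fc'; rewrite fc => -[<-]; congr (_, _).
  exact: finj fd fd'.
apply: eq_card => -[c b]; rewrite inE /=; apply/imsetP/idP => [[w /inQ]|].
  case: w => -[[a b'] c'] d /= [/andP[ab bc] cd fc fd] [-> ->].
  rewrite fc ab inE bc !andbT /=; apply/existsP; exists d.
  by rewrite fd eqxx ltnW.
case E: (f c) => [a|//]; rewrite inE => /andP[/andP[bc /existsP[d /andP[cd /eqP fd]]] ab].
have {}cd : (c < d)%N.
  rewrite ltn_neqAle cd andbT; apply: contraTneq ab => /val_inj e.
  by move: E; rewrite e fd => -[->]; rewrite ltnn.
exists (a, b, c, d) => //; rewrite inE ab bc cd blocks_crossing //.
by rewrite E fd !eqxx.
Qed.

(* A nesting (a, b, c, d) is determined by c and by the point a, open at c. *)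
Lemma restricted_nestings_opens : restricted_nestings P =
  (\sum_i (if f i is Some a then #|[set b in opens f i | (b < a)%N]| else 0))%N.
Proof.
have /valid_predP[flt finj] := pred_of_valid partP.
rewrite -(card_pairs_sum (fun a i b => (b \in opens f i) && (b < a)%N)).
pose h (w : 'I_N * 'I_N * 'I_N * 'I_N) := (w.1.2, w.1.1.1).
have inQ w : (w \in [set w : 'I_N * 'I_N * 'I_N * 'I_N | let: (a, b, c, d) := w in
     [&& (a < b)%N, (b < c)%N, (c < d)%N &
         [exists B in P, exists B' in P,
            [&& B != B', follows B a d & follows B' b c]]]]) ->
   [/\ (w.1.1.1 < w.1.1.2 < w.1.2)%N, (w.1.2 < w.2)%N, f w.2 = Some w.1.1.1
     & f w.1.2 = Some w.1.1.2].
  case: w => -[[a b] c] d; rewrite inE => /and4P[ab bc cd].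
  by rewrite blocks_nesting // => /andP[/eqP fc /eqP fd]; split; rewrite ?ab.
rewrite /restricted_nestings -(@card_in_imset _ _ h) => [|w w' /inQ + /inQ]; last first.
  case: w w' => -[[a b] c] d [[[a' b'] c'] d'] /= [_ _ fd fc] [_ _ fd' fc'] [ec ea].
  subst a' c'; move: fc'; rewrite fc => -[<-]; congr (_, _).
  exact: finj fd fd'.
apply: eq_card => -[c a]; rewrite inE /=; apply/imsetP/idP => [[w /inQ]|].
  case: w => -[[a' b] c'] d /= [/andP[ab bc] cd fd fc] [-> ->].
  rewrite fc ab inE (ltn_trans ab bc) !andbT /=; apply/existsP; exists d.
  by rewrite fd eqxx ltnW.
case E: (f c) => [b|//]; rewrite inE => /andP[/andP[ac /existsP[d /andP[cd /eqP fd]]] ab].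
have bc := flt _ _ E.
have {}cd : (c < d)%N.
  rewrite ltn_neqAle cd andbT; apply: contraTneq ab => /val_inj e.
  by move: E; rewrite e fd => -[->]; rewrite ltnn.
exists (a, b, c, d) => //; rewrite inE ab bc cd blocks_nesting //.
by rewrite E fd !eqxx.
Qed.

(** The exponents are sums over the points: those without predecessor contribute [lambda], once per
    block, and the others the powers of q and t. *)
Lemma prod_pred_weight : \prod_i pred_weight q t lambda f i =
  lambda ^+ #|P| * q ^+ restricted_crossings P * t ^+ restricted_nestings P.
Proof.
rewrite restricted_crossings_opens restricted_nestings_opens (card_pred_of_None partP).
rewrite -sum1_card !expr_sum [X in X * _ * _]big_mkcond -!big_split /=.
apply: eq_bigr => i _.
rewrite /pred_weight /step_weight inE -/f; case: (f i) => [a|] /=.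
  by rewrite mul1r.
by rewrite !mulr1.
Qed.

End PartitionWeight.

Lemma sum_partition_completions (R : realType) (q t lambda : R) (n : nat) : q != t ->
  \sum_(P : {set {set 'I_n}} | finset.partition P [set: 'I_n])
    lambda ^+ #|P| * q ^+ restricted_crossings P * t ^+ restricted_nestings P =
  completions q t lambda n 0.
Proof.
move=> qt; rewrite -(sum_pred_weight lambda qt n) -sum_partition_pred.
by apply: eq_bigr => P partP; rewrite prod_pred_weight.
Qed.

(** * Moments of the (q,t)-Poisson distribution *)

Section Moments.
Variables (R : realType) (q t lambda : R).
Variable mu : probability (measurableTypeR R) R.
Hypothesis hmu : is_qt_poisson q t lambda mu.

Local Notation C := (poisson_poly q t lambda).
Local Notation number := (qt_number q t).

(** The three-term recurrence solved for x C_k. It also covers k = 0, where [C k.-1] is C_0 but has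
    coefficient [0] = 0. *)
Lemma poisson_polyS (k : nat) :
  'X * C k = C k.+1 + (lambda + number k)%:P * C k + (lambda * number k)%:P * C k.-1.
Proof.
case: k => [|k] /=; last by rewrite -mul_polyC; ring.
by rewrite qt_number0 addr0 mulr0 polyC0 mul0r addr0 !mulr1 subrK.
Qed.

Lemma integrable_horner (p : {poly R}) :
  mu.-integrable [set: R]%classic (EFin \o horner p).
Proof.
have -> : EFin \o horner p =
    (fun x => \sum_(i < size p) ((p`_i)%:E * (x ^+ i)%:E))%E.
  by apply/funext => x /=; rewrite horner_coef -sumEFin.
apply: integrable_sum => // i _; apply: integrableZl => //.
exact: (qt_poisson_moments hmu).
Qed.

Definition moment (p : {poly R}) : R := \int[mu]_x p.[x].

Lemma momentD p r : moment (p + r) = moment p + moment r.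
Proof.
rewrite /moment -RintegralD //; try exact: integrable_horner.
by apply: eq_Rintegral => x _; rewrite hornerD.
Qed.

Lemma momentZ (c : R) p : moment (c%:P * p) = c * moment p.
Proof.
rewrite /moment -RintegralZl //; last exact: integrable_horner.
by apply: eq_Rintegral => x _; rewrite hornerM hornerC.
Qed.

(** For positive k this is orthogonality to C_0 = 1; for k = 0 it is the total mass. *)
Lemma moment_poisson_poly (k : nat) : moment (C k) = (k == 0%N)%:R.
Proof.
case: k => [|k].
  rewrite /moment; under eq_Rintegral do rewrite hornerC.
  by rewrite Rintegral_cst // mul1r; exact: (congr1 fine (probability_setT mu)).
rewrite -[RHS](qt_poisson_orthogonal hmu (isT : k.+1 != 0%N)).
by apply: eq_Rintegral => x _; rewrite [X in _ * X]hornerC mulr1.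
Qed.

(** One factor x at a time is absorbed into C_k. The scaling by lambda^k turns the coefficients 1
    and lambda [k] of C_(k+1) and C_(k-1) into lambda and [k], those of [completions]. *)
Lemma moment_completions (m k : nat) :
  moment ('X ^+ m * C k) = lambda ^+ k * completions q t lambda m k.
Proof.
elim: m k => [|m IH] k.
  by rewrite mul1r moment_poisson_poly; case: k => [|k]; rewrite ?mul1r //= mulr0.
rewrite exprSr -mulrA poisson_polyS.
have -> : 'X^m * (C k.+1 + (lambda + number k)%:P * C k + (lambda * number k)%:P * C k.-1) =
  'X^m * C k.+1 + (lambda + number k)%:P * ('X^m * C k)
   + (lambda * number k)%:P * ('X^m * C k.-1) by ring.
rewrite !momentD !momentZ !IH /=.
case: k => [|k] /=; first by rewrite qt_number0 expr1; ring.
by rewrite !exprS; ring.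
Qed.

End Moments.

(** * The one-mode Fock space *)

(** If v were nonzero, some s in S would be closer to v than 0 is, whereas orthogonality gives |v -
    s|^2 = |v|^2 + |s|^2. *)
Lemma orthogonal_dense_eq0 (R : realType) (K : normedModType R[i])
    (dotK : {dot K for Num.conj}) (S : set K) (v : K) :
  induces_norm dotK -> dense S -> (forall x, S x -> dotK x v = 0) -> v = 0.
Proof.
move=> norm dS Sv; apply/eqP/negPn/negP => v0.
have nv : 0 < `|v| by rewrite normr_gt0.
have [|s [sv Ss]] := dS (ball v `|v|) _ (ball_open v `|v|).
  by exists v; exact: ballxx.
move: sv; rewrite -ball_normE /ball_ /= => sv.
have : `|v - s| ^+ 2 < `|v| ^+ 2 by rewrite ltr_pXn2r ?nnegrE.
have e : dotK v s = 0.
  rewrite hermC expr0 mul1r; exact: etrans (congr1 _ (Sv s Ss)) (conjC0 _).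
by rewrite -!norm dnormB e conjC0 addr0 subr0 gtrDl norm le_gtF // exprn_ge0.
Qed.

Lemma sum_letter (V : nmodType) (F : letter -> V) :
  \sum_z F z = F LNumber + (F LCreation + (F LAnnihilation + F LScalar)).
Proof.
rewrite (reindex_onto letter_of_ord letter_to_ord) => [|z _]; last exact: letter_to_ordK.
rewrite (eq_bigl xpredT) => [|i]; first by rewrite !big_ord_recl big_ord0 /= addr0.
by apply/eqP/val_inj; case: i => -[|[|[|[|//]]]] ? /=; rewrite inordK.
Qed.

Lemma big_tupleS (V : nmodType) (T : finType) (n : nat) (F : n.+1.-tuple T -> V) :
  \sum_Y F Y = \sum_z \sum_(Y : n.-tuple T) F (cons_tuple z Y).
Proof.
rewrite pair_big /= (reindex (fun zY : T * n.-tuple T => cons_tuple zY.1 zY.2)) //=.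
exists (fun Y => (thead Y, behead_tuple Y)) => [[z Y] _|Y _] /=.
  by congr (_, _); apply/val_inj.
by rewrite [RHS]tuple_eta; apply/val_inj.
Qed.

(** * Powers of the Poisson type operator as sums over words *)

Section PoissonOperator.
Variables (R : realType) (lambda : R) (K : normedModType R[i]) (Ad A : {linear K -> K}).

Local Notation p := (poisson_op lambda Ad A).

Lemma poisson_op_linear : linear p.
Proof.
move=> a x y.
exact: (linearP (((Ad \o A) \+ (Num.sqrt lambda)%:C%C \*: (Ad \+ A)) \+ lambda%:C%C \*: idfun)).
Qed.

Lemma iter_poisson_linear (n : nat) : linear (iter n p).
Proof. by elim: n => // n IH a x y; rewrite !iterS IH poisson_op_linear. Qed.

Lemma iter_poisson_words (n : nat) (x : K) :
  iter n p x = \sum_(Y : n.-tuple letter) word_op lambda Ad A Y x.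
Proof.
elim: n => [|n IH].
  by rewrite (big_pred1 [tuple]) // => Y; rewrite /= [Y]tuple0; apply/esym/eqP.
have pD : {morph p : y z / y + z}.
  by move=> y z; have := poisson_op_linear 1 y z; rewrite !scale1r.
have p0 : p 0 = 0.
  by apply: (addIr (p 0)); rewrite -pD !add0r.
rewrite iterS IH (big_morph _ pD p0) big_tupleS exchange_big.
apply: eq_bigr => Y _; rewrite sum_letter /poisson_op /=.
by rewrite scalerDr !addrA.
Qed.

End PoissonOperator.

Section Fock.
Variables (R : realType) (q t lambda : R).
Hypotheses (qt : q != t) (t0 : t != 0) (lambda_ge0 : 0 <= lambda).
Variables (H : completeNormedModType R) (dotH : {dot H for idfun}) (xi : H).
Hypotheses (hH : induces_norm dotH) (hxi : `|xi| = 1).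
Hypothesis hspan : forall h : H, exists a : R, h = a *: xi.
Variables (K : completeNormedModType R[i]) (dotK : {dot K for Num.conj}).
Variable tens : seq H -> K.
Hypothesis hK : is_qt_fock q t dotH dotK tens.
Variables (Ad A : {linear K -> K}).
Hypothesis hAd : forall n : nat, Ad (tens (nseq n xi)) = tens (nseq n.+1 xi).
Hypothesis hA : is_adjoint dotK Ad A.

Local Open Scope complex_scope.
Local Notation e n := (tens (nseq n xi)).
Local Notation number := (qt_number q t).

(** All inner products of the entries equal 1, so only the inversion generating function remains. *)
Lemma dot_tens_nseq (m n : nat) :
  dotK (e m) (e n) = (if m == n then qt_fact q t n else 0)%:C.
Proof.
rewrite (qt_fock_dot hK) /qt_tensor_dot !size_nseq eq_sym.
have [->|//] := eqVneq m n; rewrite -qt_fact_inversions //.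
congr ((_ * _)%:C); apply: eq_bigr => s _; rewrite big1 ?mulr1 // => i _.
by rewrite !nth_nseq !ltn_ord hH hxi expr1n.
Qed.

(** As [H] is spanned by [xi], the entries are replaced by multiples of [xi] from left to right; [k]
    counts those already replaced. *)
Lemma tens_nseq_cat (k : nat) (w : seq H) :
  exists c : R[i], tens (nseq k xi ++ w) = c *: e (k + size w)%N.
Proof.
elim: w k => [|h w IH] k; first by exists 1; rewrite cats0 addn0 scale1r.
have [a ->] := hspan h; have [c cE] := IH k.+1.
(* Multilinearity with both vectors zero says that this tensor is twice itself. *)
have t0w : tens (nseq k xi ++ 0 :: w) = 0.
  have := qt_fock_multilinear hK (nseq k xi) w 1 0 0.
  by rewrite scale1r addr0 scale1r => /eqP; rewrite -subr_eq0 opprD addNKr oppr_eq0 => /eqP.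
exists (a%:C * c); have := qt_fock_multilinear hK (nseq k xi) w a xi 0.
rewrite addr0 t0w addr0 => ->.
have -> : nseq k xi ++ xi :: w = nseq k.+1 xi ++ w.
  by rewrite -addn1 nseqD -catA.
by rewrite cE addSnnS scalerA.
Qed.

(** Both sides are tested against the elementary tensors, which are multiples of the e_k and span a
    dense subspace. Moving [A] across as [Ad] leaves the identity [k+1]! = [k+1] [k]!. *)
Lemma annihilation_nseq (n : nat) : A (e n) = (number n)%:C *: e n.-1.
Proof.
apply/eqP; rewrite -subr_eq0; apply/eqP.
apply: (orthogonal_dense_eq0 (qt_fock_norm hK) (qt_fock_dense hK)).
move=> _ [m [c [w ->]]]; rewrite linear_sumlz big1 // => i _.
have [d /= ->] := tens_nseq_cat 0 (w i); rewrite add0n !linearZl_LR /=.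
set k := size _; have -> : dotK (e k) (A (e n) - (number n)%:C *: e n.-1) =
    dotK (e k) (A (e n)) - (number n)%:C * dotK (e k) (e n.-1).
  rewrite linearBr; congr (_ - _); apply: etrans (linearZr_LR _ _ _ _) _.
  by congr (_ * _); exact: conjc_real.
rewrite -hA hAd !dot_tens_nseq -(rmorphM (real_complex R)).
case: n => [|n] /=; first by rewrite qt_number0 mul0r subrr !mulr0.
rewrite eqSS; case: eqP => _; last by rewrite mulr0 subrr !mulr0.
by rewrite /qt_fact big_ord_recr /= [number _ * _]mulrC subrr !mulr0.
Qed.

Local Notation p := (poisson_op lambda Ad A).

Lemma poisson_op_nseq (k : nat) : p (e k) =
  (Num.sqrt lambda)%:C *: e k.+1 + ((lambda + number k)%:C *: e k
    + (Num.sqrt lambda * number k)%:C *: e k.-1).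
Proof.
have AdA : Ad ((number k)%:C *: e k.-1) = (number k)%:C *: e k.
  rewrite linearZ /= hAd; case: k => [|k //]; by rewrite qt_number0 !scale0r.
rewrite /poisson_op /number_op /= annihilation_nseq AdA hAd scalerDr scalerA.
rewrite (rmorphD (real_complex R)) (rmorphM (real_complex R) (Num.sqrt lambda)) scalerDl.
by rewrite [LHS]addrC addrA addrCA.
Qed.

(** Expanding the innermost [p] on e_k gives the recurrence of [completions]; the scaling by the
    k-th power of the square root of lambda accounts for its asymmetric coefficients lambda and
    [k]. *)
Lemma vacuum_exp_iter (m k : nat) :
  dotK (iter m p (e k)) (e 0) = (Num.sqrt lambda ^+ k * completions q t lambda m k)%:C.
Proof.
elim: m k => [|m IH] k.
  rewrite dot_tens_nseq /qt_fact big_ord0; case: k => [|k]; rewrite ?mulr1 //= mulr0 //.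
rewrite iterSr poisson_op_nseq (iter_poisson_linear lambda Ad A).
have lin := iter_poisson_linear lambda Ad A m; have iter0 : iter m p 0 = 0.
  have := lin 1 0 0; rewrite scale1r addr0 scale1r => /eqP.
  by rewrite -subr_eq0 opprD addNKr oppr_eq0 => /eqP.
have iterZ a x : iter m p (a *: x) = a *: iter m p x.
  by have := lin a x 0; rewrite addr0 iter0 addr0.
move: (e k.+1) (IH k.+1) => ek1 IH1.
rewrite lin iterZ !linearDl !linearZl_LR /= IH1 !IH.
rewrite -!(rmorphM (real_complex R)) -!(rmorphD (real_complex R));
  congr (real_complex R _).
have -> : lambda * completions q t lambda m k.+1 =
    Num.sqrt lambda ^+ 2 * completions q t lambda m k.+1 by rewrite sqr_sqrtr.
case: k {IH1} => [|k] /=; first by rewrite qt_number0; ring.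
by rewrite !exprS; ring.
Qed.

End Fock.

Theorem theorem5p7 (R : realType) (q t lambda : R)
  (hq : -1 < q < 1) (ht : `|q| < t <= 1) (hlambda : 0 < lambda)
  (H : completeNormedModType R) (dotH : {dot H for idfun})
  (hH : induces_norm dotH)
  (xi : H) (hxi : `|xi| = 1) (hspan : forall h : H, exists a : R, h = a *: xi)
  (K : completeNormedModType R[i]) (dotK : {dot K for Num.conj})
  (tens : seq H -> K) (hK : is_qt_fock q t dotH dotK tens)
  (Ad A : {linear K -> K})
  (hAd_bounded : bounded_operator Ad)
  (hAd : forall n : nat, Ad (tens (nseq n xi)) = tens (nseq n.+1 xi))
  (hA_bounded : bounded_operator A)
  (hA : is_adjoint dotK Ad A)
  (mu : probability (measurableTypeR R) R)
  (hmu : is_qt_poisson q t lambda mu)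
  (n : nat) (hn : (1 <= n)%N) :
  let phi := vacuum_exp dotK (tens [::]) in
  let p := poisson_op lambda Ad A in
  [/\ ((\int[mu]_x (x ^+ n : R))%:C)%C = phi (iter n p),
      phi (iter n p) =
        \sum_(Y : n.-tuple letter | phi (word_op lambda Ad A Y) != 0)
           phi (word_op lambda Ad A Y)
    & \sum_(Y : n.-tuple letter | phi (word_op lambda Ad A Y) != 0)
         phi (word_op lambda Ad A Y) =
      ((\sum_(P : {set {set 'I_n}} | finset.partition P [set: 'I_n])
          lambda ^+ #|P| * q ^+ restricted_crossings P
                          * t ^+ restricted_nestings P)%:C)%C].
Proof.
have [qt _] := andP ht; have t_gt0 : 0 < t by apply: le_lt_trans qt.
have q_neq_t : q != t by rewrite lt_eqF // (le_lt_trans (ler_norm q)).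
move=> phi p.
have phiE : phi (iter n p) = ((completions q t lambda n 0)%:C)%C.
  have := vacuum_exp_iter q_neq_t (lt0r_neq0 t_gt0) (ltW hlambda) hH hxi hspan hK hAd hA n 0.
  by rewrite expr0 mul1r.
have wordsE : phi (iter n p) =
    \sum_(Y : n.-tuple letter | phi (word_op lambda Ad A Y) != 0)
       phi (word_op lambda Ad A Y).
  (* The words excluded from the sum over contributors have expectation zero. *)
  rewrite {1}/phi /vacuum_exp iter_poisson_words linear_sumlz [RHS]big_mkcond /=.
  by apply: eq_bigr => Y _; case: eqP.
split=> //; last by rewrite -wordsE phiE sum_partition_completions.
rewrite phiE; congr ((_ : R)%:C)%C.
(* For k = 0 the polynomial C_0 = 1 leaves the plain moment. *)
have := moment_completions hmu n 0; rewrite expr0 !mul1r mulr1 => <-.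
by apply: eq_Rintegral => x _; rewrite hornerXn.
Qed.
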